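(* Let $G$ be an abelian group (written multiplicatively, with identity $1$) and let $(A,B)$ be a pair of nonempty finite subsets of $G$ with $|A|=|B|$. Suppose $(A,B)$ is unmatchable, as witnessed by a decomposition into a disjoint union $$A = S \cup Y,$$ where $S$ is a disjoint union of cosets of the subgroup $\langle R\rangle$ for some nonempty $R\subseteq B$, and $|Y|<|R|$. Suppose $H$ is a subgroup of $G$ satisfying $H\cap (SS^{-1}\cup RR^{-1})=\{1\}$, and let $\pi : G\to G/H$ be the corresponding quotient map. Then the projected pair $(\pi(A),\pi(B))$ is unmatchable in $G/H$.
   Context: For nonempty finite subsets $A,B$ of an abelian group $G$, a matching from $A$ to $B$ is a bijection $f:A\to B$ such that $af(a)\notin A$ for all $a\in A$. The pair $(A,B)$ is matchable if at least one matching from $A$ to $B$ exists, and unmatchable otherwise; in particular, if $|A|\neq|B|$ then $(A,B)$ is unmatchable. For a subset $X\subseteq G$, $\langle X\rangle$ denotes the subgroup of $G$ generated by $X$, and $XX^{-1}=\{xy^{-1}: x,y\in X\}$. *)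

(* Defs.v *)
From HB Require Import structures.
From mathcomp Require Import all_boot all_algebra.
From mathcomp Require Import finmap.
From mathcomp Require Import boolp classical_sets.

Set Implicit Arguments.
Unset Strict Implicit.
Unset Printing Implicit Defensive.

Import GRing.Theory.

Local Open Scope fset_scope.
Local Open Scope classical_set_scope.
Local Open Scope ring_scope.

(* An abelian group is a [zmodType], hence written additively: [a b], [x y^-1]
   and [1] become [a + b], [x - y] and [0]. *)

Definition is_matching (G : zmodType) (A B : {fset G}) (f : A -> B) : Prop :=
  bijective f /\ forall a : A, val a + val (f a) \notin A.

Definition matchable (G : zmodType) (A B : {fset G}) : Prop :=
  exists f : A -> B, is_matching f.

Definition unmatchable (G : zmodType) (A B : {fset G}) : Prop :=
  ~ matchable A B.

Definition generated_subgroup (G : zmodType) (X : set G) : set G :=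
  smallest [set K : set G | zmod_closed [in K]] X.

Definition coset (G : zmodType) (K : set G) (g : G) : set G :=
  [set g + k | k in K].

(* For [C : set (set G)], [trivIset C id] says that distinct members of [C]
   are disjoint. *)
Definition disjoint_union_of_cosets (G : zmodType) (K S : set G) : Prop :=
  exists C : set (set G),
    [/\ C `<=` range (coset K), trivIset C id & S = \bigcup_(c in C) c].

Definition difference_set (G : zmodType) (X : set G) : set G :=
  [set x - y | x in X & y in X].

(* Main.v *)
(* If [g] matched [pi A] to [pi B], then for [r] in [R] the preimage of [pi r]
   under [g] could not lie in [pi S], because [S + r] is contained in [S]. So the
   inverse of [g] would inject [pi R] into [pi Y]; but [pi] is injective on [R]
   and [#|Y| < #|R|]. *)

Require Import Defs.
From HB Require Import structures.
From mathcomp Require Import all_boot all_algebra.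
From mathcomp Require Import finmap.
From mathcomp Require Import boolp classical_sets.

Set Implicit Arguments.
Unset Strict Implicit.
Unset Printing Implicit Defensive.

Import GRing.Theory.

Local Open Scope ring_scope.
Local Open Scope quotient_scope.
Local Open Scope classical_set_scope.
Local Open Scope fset_scope.

Lemma generated_subgroup_addr (G : zmodType) (X : set G) (k x : G) :
  generated_subgroup X k -> X x -> generated_subgroup X (k + x)%R.
Proof.
move=> Xk Xx K [Kclosed subXK].
have [K0 KB] : zmod_closed [in K] := Kclosed.
have Kk : k \in K by rewrite inE; apply: Xk.
have Kx : x \in K by rewrite inE; apply: subXK.
have KNx : - x \in K by rewrite -sub0r; apply: KB.
by have := KB _ _ Kk KNx; rewrite opprK inE.
Qed.

(** Translation by an element of [X] maps each coset of the subgroup generated by [X] into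
    itself. *)
Lemma disjoint_union_of_cosets_addr (G : zmodType) (X S : set G) (s x : G) :
  disjoint_union_of_cosets (generated_subgroup X) S ->
  S s -> X x -> S (s + x)%R.
Proof.
move=> [C [Ccosets _ ->]] [c Cc cs] Xx; exists c => //.
have [g _ cE] := Ccosets c Cc; move: cs; rewrite -cE => -[k Xk <-].
by exists (k + x)%R; rewrite ?addrA//; apply: generated_subgroup_addr.
Qed.

(** Absorption of [R] by [S] is the form of the coset hypothesis that passes directly through an
    additive map, so this applies to the images in the quotient. *)
Lemma unmatchable_of_absorbing (G : zmodType) (A B S Y R : {fset G}) :
  A = S `|` Y -> R `<=` B -> (#|` Y| < #|` R|)%N ->
  {in S & R, forall s r, (s + r)%R \in S} ->
  unmatchable A B.
Proof.
move=> AE subRB ltYR SR [f [[g gK fK] fA]].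
suff: (#|` R| <= #|` Y|)%N by rewrite leqNgt ltYR.
(* The inverse of the matching, extended to all of [G]; the default value is harmless, as [h] is
   only used on [R], inside [B]. *)
pose h (r : G) : G := if insub r is Some b then val (g b) else r.
have hE (b : B) : h (val b) = val (g b) by rewrite /h valK.
have h_inj : {in R &, injective h}.
  move=> r r' /(fsubsetP subRB) Br /(fsubsetP subRB) Br'.
  rewrite (hE [` Br]) (hE [` Br']) => /val_inj /(can_inj fK).
  by move/(congr1 val).
rewrite -(card_in_imfset imfset_key h_inj).
apply/fsubset_leq_card/fsubsetP => _ /imfsetP[r /= Rr ->].
have Br := fsubsetP subRB r Rr.
rewrite (hE [` Br]); have := fA (g [` Br]); rewrite fK /=.
have SYA x : (x \in A) = (x \in S) || (x \in Y) by rewrite AE inE.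
have := valP (g [` Br]); rewrite !SYA => /orP[Sg|//].
(* A preimage in [S] would have its sum with [r] in [S], hence in [A], against [fA]. *)
by rewrite SR.
Qed.

Lemma quot_eq_subr_in (G : zmodType) (H : zmodClosed G) (x y : G) :
  \pi_(Quotient.quot H) x = \pi_(Quotient.quot H) y -> (x - y)%R \in H.
Proof. by move=> /eqP; rewrite -Quotient.idealrBE. Qed.

Theorem corollary2p10 (G : zmodType) (A B S Y R : {fset G}) (H : zmodClosed G)
    (A_neq0 : A != fset0) (B_neq0 : B != fset0) (cardAB : #|` A| = #|` B|)
    (unmatchable_AB : unmatchable A B)
    (A_decomp : A = S `|` Y) (disjoint_SY : [disjoint S & Y])
    (R_neq0 : R != fset0) (sub_RB : R `<=` B)
    (S_cosets : disjoint_union_of_cosets (generated_subgroup [set` R]) [set` S])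
    (card_YR : (#|` Y| < #|` R|)%N)
    (H_trivial : ([set` H] `&`
       (difference_set [set` S] `|` difference_set [set` R]) = [set 0])%classic) :
  unmatchable [fset \pi_(Quotient.quot H) a | a in A] [fset \pi_(Quotient.quot H) b | b in B].
Proof.
set p := \pi_(Quotient.quot H).
have p_inj : {in R &, injective p}.
  move=> x y Rx Ry /quot_eq_subr_in Hxy; apply/eqP; rewrite -subr_eq0; apply/eqP.
  (* The difference lies both in [H] and in the difference set of [R]. *)
  suff : [set 0]%classic (x - y)%R by [].
  by rewrite -H_trivial; split=> //; right; exists x => //; exists y.
apply: (@unmatchable_of_absorbing _ _ _ (p @` S) (p @` Y) (p @` R)).
- by rewrite A_decomp imfsetU.
- by apply: subset_imfset => x; exact: (fsubsetP sub_RB x).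
(* Projecting keeps the size of [R], by [p_inj], and cannot enlarge [Y]. *)
- rewrite [ltnRHS]card_in_imfset //.
  by apply: leq_ltn_trans card_YR; apply: leq_imfset_card.
- move=> _ _ /imfsetP[s /= Ss ->] /imfsetP[r /= Rr ->].
  rewrite -raddfD; apply: in_imfset.
  exact: (disjoint_union_of_cosets_addr S_cosets Ss Rr).
Qed.
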